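(* Each elementary divisor ring is an $SE_2$ ring.
   Context: All rings are commutative with identity. Two matrices $B,C\in\mathbb{M}_{m\times n}(R)$ are equivalent if $C=MBN$ for some $M\in GL_m(R)$, $N\in GL_n(R)$. A matrix $B\in\mathbb{M}_{m\times n}(R)$ admits diagonal reduction if it is equivalent to a matrix whose off-diagonal entries are $0$ and whose diagonal entries $b_{1,1},\dots,b_{s,s}$, $s=\min\{m,n\}$, satisfy that $b_{i,i}$ divides $b_{i+1,i+1}$ for all $1\le i\le s-1$. $R$ is an elementary divisor ring (EDR) if all matrices with entries in $R$ admit diagonal reduction. A matrix in $\mathbb{M}_2(R)$ is unimodular if its four entries generate the unit ideal; $Um(\mathbb{M}_2(R))$ is the set of such matrices. A matrix $A\in\mathbb{M}_2(R)$ is simply extendable if there exists $A^+\in SL_3(R)$ whose upper-left $2\times 2$ block is $A$ and whose $(3,3)$ entry is $0$. $R$ is an $SE_2$ ring if each matrix in $Um(\mathbb{M}_2(R))$ is simply extendable. *)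

(* Defs.v *)
From HB Require Import structures.
From mathcomp Require Import all_boot all_order all_algebra.

Set Implicit Arguments.
Unset Strict Implicit.
Unset Printing Implicit Defensive.

Import GRing.Theory.
Local Open Scope ring_scope.

(* [comPzRingType] (rather than [comNzRingType]) is used throughout, so that
   the zero ring is not excluded. *)

Definition divides (R : comPzRingType) (a b : R) : Prop :=
  exists c : R, b = c * a.

(* The library's [unitmx] is not available here: it requires decidable
   invertibility in [R]. *)
Definition inGL (R : comPzRingType) (n : nat) (M : 'M[R]_n) : Prop :=
  exists M' : 'M[R]_n, M *m M' = 1%:M /\ M' *m M = 1%:M.

Definition inSL (R : comPzRingType) (n : nat) (M : 'M[R]_n) : Prop :=
  \det M = 1.

Definition equivalent_mx (R : comPzRingType) (m n : nat)
    (B C : 'M[R]_(m, n)) : Prop :=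
  exists (M : 'M[R]_m) (N : 'M[R]_n), [/\ inGL M, inGL N & C = M *m B *m N].

Definition divisibility_chain (R : comPzRingType) (m n : nat)
    (D : 'M[R]_(m, n)) : Prop :=
  forall (i i' : 'I_m) (j j' : 'I_n),
    i = j :> nat -> i' = j' :> nat -> i' = i.+1 :> nat ->
    divides (D i j) (D i' j').

Definition admits_diagonal_reduction (R : comPzRingType) (m n : nat)
    (B : 'M[R]_(m, n)) : Prop :=
  exists D : 'M[R]_(m, n),
    [/\ equivalent_mx B D, is_diag_mx D & divisibility_chain D].

(* Empty matrices (m = 0 or n = 0) are included; they admit diagonal
   reduction over every ring. *)
Definition elementary_divisor_ring (R : comPzRingType) : Prop :=
  forall (m n : nat) (B : 'M[R]_(m, n)), admits_diagonal_reduction B.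

Definition in_entry_ideal (R : comPzRingType) (m n : nat)
    (A : 'M[R]_(m, n)) (x : R) : Prop :=
  exists C : 'M[R]_(m, n), x = \sum_i \sum_j C i j * A i j.

Definition unimodular (R : comPzRingType) (A : 'M[R]_2) : Prop :=
  forall x : R, in_entry_ideal A x.

(* The size is written [2 + 1] so that [ulsubmx] is the upper-left 2 x 2
   block. *)
Definition simply_extendable (R : comPzRingType) (A : 'M[R]_2) : Prop :=
  exists Aplus : 'M[R]_(2 + 1),
    [/\ inSL Aplus, ulsubmx Aplus = A
      & Aplus (ord_max : 'I_3) (ord_max : 'I_3) = 0].

Definition SE2_ring (R : comPzRingType) : Prop :=
  forall A : 'M[R]_2, unimodular A -> simply_extendable A.

(* Main.v *)
Require Import Defs.
From mathcomp Require Import all_boot all_order all_algebra.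
From mathcomp Require Import ring.

(** Bordering a 2 x 2 matrix [A] by a column [u], a row [v] and a corner [0]
    gives a matrix of determinant [- v *m \adj A *m u]. For 2 x 2 matrices the
    adjugate is the transpose of [A] conjugated by a rotation by a right angle,
    so [A] is simply extendable as soon as the bilinear form
    [(x, y) |-> x *m A *m y] takes the value 1 ([simply_extendable_bilinear]).

    If [M *m A *m N] is a diagonal reduction [D] of [A], its first diagonal
    entry [D 0 0] divides every entry of [D], hence every entry of [A], since
    [A] is obtained from [D] by multiplying by inverses of [M] and [N]. When
    [A] is unimodular, [D 0 0] is therefore a unit. As it is the value of the
    form at the first row of [M] and the first column of [N], rescaling the
    row makes the form take the value 1. *)

Set Implicit Arguments.
Unset Strict Implicit.
Unset Printing Implicit Defensive.

Import GRing.Theory.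
Local Open Scope ring_scope.

Section Divisibility.
Variable R : comPzRingType.
Implicit Types a b c : R.

Lemma divides0 a : divides a 0.
Proof. by exists 0; rewrite mul0r. Qed.

Lemma divides_refl a : divides a a.
Proof. by exists 1; rewrite mul1r. Qed.

Lemma dividesMl a b c : divides a b -> divides a (c * b).
Proof. by case=> d ->; exists (c * d); rewrite mulrA. Qed.

Lemma divides_sum a (I : finType) (F : I -> R) :
  (forall i, divides a (F i)) -> divides a (\sum_i F i).
Proof.
move=> aF; elim/big_ind: _ => [|b c [b' ->] [c' ->]|i _].
- exact: divides0.
- by exists (b' + c'); rewrite mulrDl.
- exact: aF.
Qed.

Lemma divides_mulmx a m n p q (L : 'M[R]_(m, n)) (B : 'M[R]_(n, p))
    (K : 'M[R]_(p, q)) :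
    (forall i j, divides a (B i j)) ->
  forall i j, divides a ((L *m B *m K) i j).
Proof.
move=> aB i j; rewrite mxE; apply: divides_sum => k.
rewrite mulrC; apply: dividesMl; rewrite mxE; apply: divides_sum => l.
exact: dividesMl.
Qed.

Lemma divides_in_entry_ideal a m n (A : 'M[R]_(m, n)) b :
  (forall i j, divides a (A i j)) -> in_entry_ideal A b -> divides a b.
Proof.
move=> aA [C ->]; apply: divides_sum => i; apply: divides_sum => j.
exact: dividesMl.
Qed.

(** Only 2 x 2 matrices are treated: the chain condition relates [D 0 0] to
    [D 1 1] in a single step. *)
Lemma divides_diag2 (D : 'M[R]_2) :
  is_diag_mx D -> divisibility_chain D -> forall i j, divides (D 0 0) (D i j).
Proof.
move=> /is_diag_mxP Ddiag Dchain i j.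
have [eq_ij | ne_ij] := eqVneq (i : nat) j; last first.
  by rewrite (Ddiag i j ne_ij); apply: divides0.
have -> : j = i by apply: val_inj; rewrite /= eq_ij.
case: i {eq_ij} => [[|[|//]] lti].
  by rewrite (_ : Ordinal lti = 0); [apply: divides_refl | apply: val_inj].
exact: (Dchain 0 (Ordinal lti) 0 (Ordinal lti)).
Qed.

End Divisibility.

(** The 3 x 3 determinant, with rows and columns indexed as in a block matrix
    whose upper-left block is 2 x 2. *)
Lemma det_mx_add21 (R : comPzRingType) (B : 'M[R]_(2 + 1))
    (i0 := lshift 1 0) (i1 := lshift 1 1) (i2 := rshift 2 0) :
  \det B = B i0 i0 * (B i1 i1 * B i2 i2 - B i1 i2 * B i2 i1)
         - B i0 i1 * (B i1 i0 * B i2 i2 - B i1 i2 * B i2 i0)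
         + B i0 i2 * (B i1 i0 * B i2 i1 - B i1 i1 * B i2 i0).
Proof.
(* Entries are compared through the values in nat of their indices. *)
pose b (i j : nat) := B (inord i) (inord j).
have bE i j : B i j = b i j by rewrite /b !inord_val.
rewrite (expand_det_row _ 0) !big_ord_recl big_ord0 /cofactor.
rewrite !(expand_det_row _ 0) !big_ord_recl !big_ord0 /cofactor !det_mx11.
rewrite !mxE !bE /=.
ring.
Qed.

(** The border is [u = (- x_1, x_0)], [v = (y_1, - y_0)], the vectors [x] and
    [y] turned by right angles, so that [- v *m \adj A *m u = x *m A *m y]. *)
Lemma simply_extendable_bilinear (R : comPzRingType) (A : 'M[R]_2)
    (x : 'rV[R]_2) (y : 'cV[R]_2) :
  (x *m A *m y) 0 0 = 1 -> simply_extendable A.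
Proof.
rewrite mxE !big_ord_recl big_ord0 !mxE !big_ord_recl !big_ord0 /=.
rewrite (_ : lift ord0 ord0 = 1); last exact: val_inj.
pose u : 'cV[R]_2 := \col_i (if i == 0 then - x 0 1 else x 0 0).
pose v : 'rV[R]_2 := \row_j (if j == 0 then y 1 0 else - y 0 0).
move=> xAy1; exists (block_mx A u v 0); split; last 1 first.
- rewrite (_ : ord_max = rshift 2 0); last exact: val_inj.
  by rewrite block_mxEdr mxE.
- rewrite /inSL det_mx_add21.
  rewrite !block_mxEul !block_mxEur !block_mxEdl !block_mxEdr !mxE /=.
  rewrite -[RHS]xAy1; ring.
- exact: block_mxKul.
Qed.

Theorem proposition1p3 (R : comPzRingType) :
  elementary_divisor_ring R -> SE2_ring R.
Proof.
move=> edr A A_unimod.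
have [D [[M [N [[M' [_ M'M]] [N' [NN' _]] defD]]] Ddiag Dchain]] := edr _ _ A.
have defA : A = M' *m D *m N'.
  by rewrite defD !mulmxA M'M mul1mx -mulmxA NN' mulmx1.
have [c Dc] : divides (D 0 0) 1.
  apply: divides_in_entry_ideal (A_unimod 1) => i j.
  by rewrite defA; apply: divides_mulmx; apply: divides_diag2.
apply: (@simply_extendable_bilinear _ A (c *: row 0 M) (col 0 N)).
rewrite -!scalemxAl -row_mul mxE [RHS]Dc defD [in RHS]mxE mxE.
by congr (c * _); apply: eq_bigr => k _; rewrite mxE [col 0 N _ _]mxE.
Qed.
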